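(* The class $\mathcal{E}$ of magma homomorphisms is not closed under composition, whereas the class $\mathcal{E}'$ is closed under composition.
   Context: A (unitary) magma is a set $M$ with an element $0$ and a binary operation $+$ satisfying $0+x=x=x+0$ for all $x\in M$ (no other axiom). A magma homomorphism is a map preserving $0$ and $+$. Sums of maps are taken pointwise; $1$ denotes identity maps and $0$ also denotes constant zero maps. Split extension of magmas: a seven-tuple $E=(B,X,A,\alpha,\beta,\kappa,\lambda)$ where $B,X,A$ are magmas, $\alpha:A\to B$, $\beta:B\to A$, $\kappa:X\to A$ are magma homomorphisms, $\lambda:A\to X$ is a map with $\lambda(0)=0$ (not necessarily preserving addition), and, for all $x\in X$, $a\in A$, $b\in B$: $\lambda\kappa=1$, $\alpha\beta=1$; $\lambda\beta=0$, $\alpha\kappa=0$; $\kappa\lambda+\beta\alpha=1$; $\lambda(\kappa(x)+\beta(b))=x$; $\kappa(x)+(\beta(b)+a)=(\kappa(x)+\beta(b))+a$; $\kappa(x)+(a+\beta(b))=(\kappa(x)+a)+\beta(b)$; $a+(\kappa(x)+\beta(b))=(a+\kappa(x))+\beta(b)$. The associated action of $B$ on $X$ is $bx=\lambda(\beta(b)+\kappa(x))$. The split extension $E$ is called firm if $b'(bx)=(b'+b)x$ for all $b,b'\in B$, $x\in X$, for this associated action. $\mathcal{E}$ is the class of all magma homomorphisms $\alpha:A\to B$ for which there exists a split extension $(B,X,A,\alpha,\beta,\kappa,\lambda)$ with the same $\alpha$. $\mathcal{E}'$ is defined in the same way except that the split extension is required to be firm. *)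

(* Defs.v *)
From HB Require Import structures.
From mathcomp Require Import all_boot all_order all_algebra.

Set Implicit Arguments.
Unset Strict Implicit.
Unset Printing Implicit Defensive.

Import GRing.Theory.
Local Open Scope ring_scope.

(* MathComp's addUMagmaType is commutative and carries a choice structure;
   here neither is assumed, so the two unit laws are added directly on top of
   the axiom-free baseAddUMagmaType.  Magma homomorphisms are then exactly
   {additive U -> V}: maps that preserve 0 and +. *)
HB.mixin Record isUnitaryMagma V of GRing.BaseAddUMagma V := {
  addm0 : right_id (0 : V) +%R;
  add0m : left_id (0 : V) +%R
}.

#[short(type="unitaryMagmaType")]
HB.structure Definition UnitaryMagma :=
  {V of isUnitaryMagma V & GRing.BaseAddUMagma V}.

Record split_extension (B X A : unitaryMagmaType)
    (alpha : {additive A -> B}) (beta : {additive B -> A})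
    (kappa : {additive X -> A}) (lambda : A -> X) : Prop := SplitExtension {
  lambda_0 : lambda 0 = 0;
  lambda_kappa : forall x, lambda (kappa x) = x;
  alpha_beta : forall b, alpha (beta b) = b;
  lambda_beta : forall b, lambda (beta b) = 0;
  alpha_kappa : forall x, alpha (kappa x) = 0;
  kappa_lambda_beta_alpha : forall a, kappa (lambda a) + beta (alpha a) = a;
  lambda_kappa_beta : forall x b, lambda (kappa x + beta b) = x;
  kappa_beta_addA : forall x b a,
    kappa x + (beta b + a) = (kappa x + beta b) + a;
  kappa_addA_beta : forall x a b,
    kappa x + (a + beta b) = (kappa x + a) + beta b;
  addA_kappa_beta : forall a x b,
    a + (kappa x + beta b) = (a + kappa x) + beta b
}.

Definition action (B X A : unitaryMagmaType) (beta : B -> A) (kappa : X -> A)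
    (lambda : A -> X) (b : B) (x : X) : X := lambda (beta b + kappa x).

Definition firm (B X A : unitaryMagmaType) (beta : B -> A) (kappa : X -> A)
    (lambda : A -> X) : Prop :=
  forall b b' x, action beta kappa lambda b' (action beta kappa lambda b x)
                 = action beta kappa lambda (b' + b) x.

Definition classE (A B : unitaryMagmaType) (alpha : {additive A -> B}) : Prop :=
  exists (X : unitaryMagmaType) (beta : {additive B -> A})
    (kappa : {additive X -> A}) (lambda : A -> X),
    split_extension alpha beta kappa lambda.

Definition classE' (A B : unitaryMagmaType) (alpha : {additive A -> B}) : Prop :=
  exists (X : unitaryMagmaType) (beta : {additive B -> A})
    (kappa : {additive X -> A}) (lambda : A -> X),
    split_extension alpha beta kappa lambda /\ firm beta kappa lambda.

Definition closed_under_composition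
    (P : forall A B : unitaryMagmaType, {additive A -> B} -> Prop) : Prop :=
  forall (A B C : unitaryMagmaType)
    (f : {additive A -> B}) (g : {additive B -> C}),
    P A B f -> P B C g -> P A C (g \o f).

(* Main.v *)
Require Import Defs.
From HB Require Import structures.
From mathcomp Require Import all_boot all_order all_algebra.

(** Sending (x, b) to kappa x + beta b identifies the middle magma A of a split
    extension with X * B carrying the semidirect addition
      (x, b) + (x', b') = (x + b x', b + b'),
    and conversely every map (b, x) |-> b x with 0 x = x and b 0 = 0 arises in
    this way (split_extension_addE, split_extension_of_addE).

    Let f : A -> B and g : B -> C belong to split extensions with kernels X and
    Y.  In the coordinates (x, (y, c)) of A, the axioms for g \o f with the
    section c |-> (0, (0, c)) require that y (c x) = (y + c) x.  If the extension of f is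
    firm, this holds; then g \o f is the projection of a semidirect product of
    X x| Y and C, with C acting componentwise, and this action is firm as soon
    as both given ones are (closed_classE').

    Without firmness, let X = Y = {0, 1} under disjunction and C = Z/2, with C
    acting trivially on Y, and let every element of Y x C fix X pointwise
    except (1, 1), which annihilates X.  Disjunction has no invertible element
    but 0, so c |-> (0, (0, c)) is the only section of the composite.  Then the
    axiom kappa k + (beta c + a) = (kappa k + beta c) + a fails: it would give
    1 = y (c x) = (y + c) x = 0 for x = y = c = 1. *)

Set Implicit Arguments.
Unset Strict Implicit.
Unset Printing Implicit Defensive.

Import GRing.Theory.
Local Open Scope ring_scope.

Record magma_action (B X : unitaryMagmaType) := MagmaAction {
  act :> B -> X -> X;
  act0m : forall x, act 0 x = x;
  actm0 : forall b, act b 0 = 0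
}.

(** * Split extensions and semidirect addition *)

Section SemidirectAddition.

Variables (B X A : unitaryMagmaType) (alpha : {additive A -> B})
  (beta : {additive B -> A}) (kappa : {additive X -> A}) (lambda : A -> X).

Section OfSplitExtension.

Hypothesis E : split_extension alpha beta kappa lambda.

Lemma split_extension_act0m x : action beta kappa lambda 0 x = x.
Proof. by rewrite /action raddf0 add0m (lambda_kappa E). Qed.

Lemma split_extension_actm0 b : action beta kappa lambda b 0 = 0.
Proof. by rewrite /action raddf0 addm0 (lambda_beta E). Qed.

Definition split_extension_action : magma_action B X :=
  MagmaAction split_extension_act0m split_extension_actm0.

Lemma alpha_kappa_beta x b : alpha (kappa x + beta b) = b.
Proof. by rewrite raddfD (alpha_kappa E) (alpha_beta E) add0m. Qed.

(** Decomposing beta b + kappa x' along kappa lambda + beta alpha = 1 gives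
    kappa (b x') + beta b; the three associativity axioms move the remaining
    brackets. *)
Lemma split_extension_addE x b x' b' :
  (kappa x + beta b) + (kappa x' + beta b')
  = kappa (x + split_extension_action b x') + beta (b + b').
Proof.
have bxE : beta b + kappa x' = kappa (split_extension_action b x') + beta b.
  rewrite -{1}(kappa_lambda_beta_alpha E (beta b + kappa x')).
  by rewrite raddfD (alpha_beta E) (alpha_kappa E) addm0.
rewrite (addA_kappa_beta E) -(kappa_beta_addA E) bxE (kappa_addA_beta E).
by rewrite -(raddfD kappa) -(kappa_addA_beta E) -raddfD.
Qed.

(** Any element of the kernel of alpha is in the image of kappa. *)
Lemma kernel_beta_addA k b a :
  alpha k = 0 -> k + (beta b + a) = (k + beta b) + a.
Proof.
move=> k0; have kE := kappa_lambda_beta_alpha E k.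
by rewrite k0 raddf0 addm0 in kE; rewrite -kE (kappa_beta_addA E).
Qed.

End OfSplitExtension.

(** In coordinates (x, b), the two sides of each associativity axiom reduce to
    the same pair by the unit laws, 0 x = x and b 0 = 0. *)
Lemma split_extension_of_addE (phi : magma_action B X) :
    cancel beta alpha -> (forall x, alpha (kappa x) = 0) ->
    (forall a, kappa (lambda a) + beta (alpha a) = a) ->
    (forall x b, lambda (kappa x + beta b) = x) ->
    (forall x b x' b', (kappa x + beta b) + (kappa x' + beta b')
       = kappa (x + phi b x') + beta (b + b')) ->
  split_extension alpha beta kappa lambda
  /\ (forall b x, action beta kappa lambda b x = phi b x).
Proof.
move=> alphaK alpha0 decomp lambdaE addE.
have kappaE x : kappa x = kappa x + beta 0 by rewrite raddf0 addm0.
have betaE b : beta b = kappa 0 + beta b by rewrite raddf0 add0m.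
have simp := (addE, addm0, add0m, act0m, actm0).
split; first split.
- by rewrite -{1}(raddf0 kappa) kappaE lambdaE.
- by move=> x; rewrite kappaE lambdaE.
- exact: alphaK.
- by move=> b; rewrite betaE lambdaE.
- exact: alpha0.
- exact: decomp.
- exact: lambdaE.
- move=> x b a; rewrite -(decomp a) [in LHS]betaE [kappa x in LHS]kappaE.
  by rewrite !simp.
- move=> x a b; rewrite -(decomp a) [beta b]betaE [kappa x]kappaE.
  by rewrite !simp.
- move=> a x b; rewrite -(decomp a) [beta b in RHS]betaE [kappa x in RHS]kappaE.
  by rewrite !simp.
by move=> b x; rewrite /action betaE (kappaE x) addE lambdaE add0m.
Qed.

End SemidirectAddition.

Definition sdprod (B X : unitaryMagmaType) (phi : magma_action B X) : Type :=
  (X * B)%type.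

Section SemidirectProduct.

Variables (B X : unitaryMagmaType) (phi : magma_action B X).

Definition sdprod_add (u v : sdprod phi) : sdprod phi :=
  (u.1 + phi u.2 v.1, u.2 + v.2).

HB.instance Definition _ := GRing.hasAdd.Build (sdprod phi) sdprod_add.
HB.instance Definition _ := GRing.hasZero.Build (sdprod phi) (0, 0).

Lemma sdprod_addm0 : right_id (0 : sdprod phi) +%R.
Proof.
by case=> x b; rewrite [LHS]/GRing.add /= /sdprod_add /= actm0 !addm0.
Qed.

Lemma sdprod_add0m : left_id (0 : sdprod phi) +%R.
Proof.
by case=> x b; rewrite [LHS]/GRing.add /= /sdprod_add /= act0m !add0m.
Qed.

HB.instance Definition _ :=
  isUnitaryMagma.Build (sdprod phi) sdprod_addm0 sdprod_add0m.

Lemma sdprod_addE (x x' : X) (b b' : B) :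
  ((x, b) : sdprod phi) + ((x', b') : sdprod phi) = (x + phi b x', b + b').
Proof. by []. Qed.

Definition sdprod_snd (u : sdprod phi) : B := u.2.
Definition sdprod_inl (x : X) : sdprod phi := (x, 0).
Definition sdprod_inr (b : B) : sdprod phi := (0, b).

Lemma sdprod_snd_morphism : nmod_morphism sdprod_snd.
Proof. by []. Qed.

Lemma sdprod_inl_morphism : nmod_morphism sdprod_inl.
Proof. by split=> // x y; rewrite sdprod_addE act0m addm0. Qed.

Lemma sdprod_inr_morphism : nmod_morphism sdprod_inr.
Proof. by split=> // b c; rewrite sdprod_addE actm0 addm0. Qed.

HB.instance Definition _ :=
  GRing.isNmodMorphism.Build _ _ sdprod_snd sdprod_snd_morphism.
HB.instance Definition _ :=
  GRing.isNmodMorphism.Build _ _ sdprod_inl sdprod_inl_morphism.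
HB.instance Definition _ :=
  GRing.isNmodMorphism.Build _ _ sdprod_inr sdprod_inr_morphism.

Lemma classE_sdprod_snd : classE sdprod_snd.
Proof.
exists X, sdprod_inr, sdprod_inl, fst.
have inE x b : sdprod_inl x + sdprod_inr b = (x, b).
  by rewrite sdprod_addE actm0 addm0 add0m.
have [] // := @split_extension_of_addE _ _ _
  sdprod_snd sdprod_inr sdprod_inl fst phi.
- by case=> x b; rewrite inE.
- by move=> x b; rewrite inE.
- by move=> x b x' b'; rewrite !inE.
Qed.

End SemidirectProduct.

(** * Composites of firm split extensions *)

Section FirmComposite.

Variables (A B C X Y : unitaryMagmaType).
Variables (f : {additive A -> B}) (betaf : {additive B -> A}).
Variables (kappaf : {additive X -> A}) (lambdaf : A -> X).
Variables (g : {additive B -> C}) (betag : {additive C -> B}).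
Variables (kappag : {additive Y -> B}) (lambdag : B -> Y).
Hypotheses (Ef : split_extension f betaf kappaf lambdaf)
  (Eg : split_extension g betag kappag lambdag).
Hypotheses (firmf : firm betaf kappaf lambdaf)
  (firmg : firm betag kappag lambdag).

Local Notation phi := (split_extension_action Ef).
Local Notation psi := (split_extension_action Eg).

Lemma comp_kernel_act0m x : phi (kappag 0) x = x.
Proof. by rewrite raddf0 act0m. Qed.

Definition comp_kernel_action : magma_action Y X :=
  @MagmaAction Y X (phi \o kappag) comp_kernel_act0m
    (fun y => actm0 phi (kappag y)).

(** The kernel of g \o f is X x| Y, with Y acting through kappag. *)
Local Notation K := (sdprod comp_kernel_action).

Definition comp_kappa (u : K) : A := kappaf u.1 + betaf (kappag u.2).
Definition comp_lambda (a : A) : K := (lambdaf a, lambdag (f a)).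

Lemma comp_kappa_morphism : nmod_morphism comp_kappa.
Proof.
split; first by rewrite /comp_kappa !raddf0 addm0.
case=> x y [x' y']; rewrite sdprod_addE /comp_kappa /=.
by rewrite (split_extension_addE Ef) (raddfD kappag).
Qed.

HB.instance Definition _ :=
  GRing.isNmodMorphism.Build K A comp_kappa comp_kappa_morphism.

Definition comp_act (c : C) (u : K) : K := (phi (betag c) u.1, psi c u.2).

Lemma comp_act0m u : comp_act 0 u = u.
Proof. by case: u => x y; rewrite /comp_act (raddf0 betag) !act0m. Qed.

Lemma comp_actm0 c : comp_act c 0 = 0.
Proof. by rewrite /comp_act !actm0. Qed.

Definition comp_action : magma_action C K :=
  MagmaAction comp_act0m comp_actm0.

Lemma comp_kappa_betaE (u : K) c :
  comp_kappa u + betaf (betag c)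
  = kappaf u.1 + betaf (kappag u.2 + betag c).
Proof. by rewrite -(kappa_addA_beta Ef) -(raddfD betaf). Qed.

(** Firmness of f enters here, as kappag y (betag c x') =
    (kappag y + betag c) x'. *)
Lemma comp_addE (u : K) c (u' : K) c' :
  (comp_kappa u + betaf (betag c)) + (comp_kappa u' + betaf (betag c'))
  = comp_kappa (u + comp_action c u') + betaf (betag (c + c')).
Proof.
case: u u' => x y [x' y'].
rewrite !comp_kappa_betaE (split_extension_addE Ef) (split_extension_addE Eg).
by rewrite sdprod_addE /= (firmf (betag c) (kappag y)).
Qed.

Lemma comp_split_extension :
  split_extension (g \o f) (betaf \o betag) comp_kappa comp_lambda
  /\ forall c u, action (betaf \o betag) comp_kappa comp_lambda c u
                 = comp_action c u.
Proof.
apply: split_extension_of_addE.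
- by move=> c /=; rewrite (alpha_beta Ef) (alpha_beta Eg).
- by case=> x y; rewrite /= (alpha_kappa_beta Ef) (alpha_kappa Eg).
- move=> a /=; rewrite comp_kappa_betaE /= (kappa_lambda_beta_alpha Eg).
  exact: (kappa_lambda_beta_alpha Ef).
- case=> x y c; rewrite /= comp_kappa_betaE /comp_lambda /=.
  by rewrite (lambda_kappa_beta Ef) (alpha_kappa_beta Ef) (lambda_kappa_beta Eg).
- exact: comp_addE.
Qed.

Lemma comp_classE' : classE' (g \o f).
Proof.
have [E actE] := comp_split_extension.
exists K, (betaf \o betag), comp_kappa, comp_lambda; split=> // c c' [x y].
rewrite !actE /= /comp_act /= (raddfD betag).
by congr (_, _); [exact: firmf | exact: firmg].
Qed.

End FirmComposite.

Lemma closed_classE' : closed_under_composition classE'.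
Proof.
move=> A B C f g [X [bf [kf [lf [Ef firmf]]]]] [Y [bg [kg [lg [Eg firmg]]]]].
exact: (comp_classE' Ef Eg firmf firmg).
Qed.

(** * A composite that is not a split extension *)

Definition or_bool : Type := bool.

HB.instance Definition _ := GRing.hasAdd.Build or_bool orb.
HB.instance Definition _ := GRing.hasZero.Build or_bool false.
HB.instance Definition _ := isUnitaryMagma.Build or_bool orbF orFb.

(** The canonical addition on bool is exclusive or: this is Z/2. *)
HB.instance Definition _ := isUnitaryMagma.Build bool addbF addFb.

Definition trivial_action (B X : unitaryMagmaType) : magma_action B X :=
  @MagmaAction B X (fun _ x => x) (fun=> erefl) (fun=> erefl).

Local Notation YC := (sdprod (trivial_action bool or_bool)).

Definition cut_act (b : YC) (x : or_bool) : or_bool :=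
  ~~ (b.1 && b.2) && x.

Lemma cut_act0m x : cut_act 0 x = x.
Proof. by []. Qed.

Lemma cut_actm0 b : cut_act b 0 = 0.
Proof. exact: andbF. Qed.

Definition cut_action : magma_action YC or_bool :=
  MagmaAction cut_act0m cut_actm0.

Local Notation XYC := (sdprod cut_action).
Local Notation cut_proj :=
  (sdprod_snd (phi := trivial_action bool or_bool)
     \o sdprod_snd (phi := cut_action)).

(** The section takes 1 to an element (s, (t, 1)) of order 2, whose double has
    components s and t because the addition is disjunction. *)
Lemma cut_proj_section (beta : {additive bool -> XYC}) :
  cancel beta cut_proj -> beta true = (false, (false, true)).
Proof.
move=> betaK; have := betaK true.
have : beta true + beta true = 0 by rewrite -raddfD raddf0.
by case: (beta true) => [[] [[] []]].
Qed.

Lemma not_classE_cut_proj : ~ classE cut_proj.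
Proof.
case=> X [beta [kappa [lambda E]]].
have beta1 := cut_proj_section (alpha_beta E).
(* k = (0, (y, 0)) and a = (x, (0, 0)) with x = y = 1 and c = 1. *)
have := @kernel_beta_addA _ _ _ _ _ _ _ E
  ((false, (true, false)) : XYC) true (true, (false, false)) erefl.
by rewrite beta1.
Qed.

Lemma not_closed_classE : ~ closed_under_composition classE.
Proof.
move=> closedE; apply: not_classE_cut_proj.
by apply: closedE; exact: classE_sdprod_snd.
Qed.

Theorem mainTheorem5 :
  ~ closed_under_composition classE /\ closed_under_composition classE'.
Proof. by split; [exact: not_closed_classE | exact: closed_classE']. Qed.
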